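(* Let $(R,\mathfrak{m})$ be a local Gaussian ring whose nilradical is equal to its maximal ideal $\mathfrak{m}$. If $\mathfrak{m}$ is not nilpotent (i.e. $\mathfrak{m}^k\neq 0$ for all $k\geq 1$), then the weak global dimension of $R$ is $\infty$.
   Context: All rings are commutative with unit; $(R,\mathfrak{m})$ local means that $\mathfrak{m}$ is the unique maximal ideal of $R$ ($R$ not necessarily Noetherian). For a polynomial $f\in R[x]$, the content $c(f)$ is the ideal of $R$ generated by the coefficients of $f$. The ring $R$ is called Gaussian if $c(f)c(g)=c(fg)$ for all $f,g\in R[x]$. The flat dimension $\mathrm{fd}(M)$ of an $R$-module $M$ is the smallest $n$ such that there is a resolution $0\to F_n\to\cdots\to F_0\to M\to 0$ by flat $R$-modules, and $\infty$ if no finite such resolution exists. The weak global dimension of $R$ is $\sup\{\mathrm{fd}(M)\mid M \text{ an } R\text{-module}\}$. *)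

(* Defs.v *)
From HB Require Import structures.
From mathcomp Require Import all_boot all_order all_algebra.
From mathcomp Require Import boolp classical_sets constructive_ereal.
From mathcomp.multinomials Require Import freeg.

Set Implicit Arguments.
Unset Strict Implicit.
Unset Printing Implicit Defensive.

Import Order.TTheory GRing.Theory Num.Theory.
Local Open Scope quotient_scope.
Local Open Scope classical_set_scope.
Local Open Scope ring_scope.

Definition span (R : comNzRingType) (V : lmodType R) (G : set V) : set V :=
  smallest (fun N : set V => submod_closed [in N]) G.

Lemma span_submod (R : comNzRingType) (V : lmodType R) (G : set V) :
  submod_closed [in span G].
Proof.
split=> [|a u v]; rewrite !inE.
  by move=> N [/= [N0 _] _]; move: N0; rewrite !inE.
move=> Su Sv N /= NG; have [[_ Nlin] _] := NG.
have := Nlin a u v; rewrite !inE; apply; [exact: Su | exact: Sv].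
Qed.

(** [quotmod G] is the quotient of [V] by the submodule generated by [G]. *)
Section QuotientModule.
Variables (R : comNzRingType) (V : lmodType R) (G : set V).

Definition span_pred : {pred V} := [in span G].

Lemma span_predP v : (v \in span_pred) <-> span G v.
Proof. by rewrite -[X in _ <-> X](in_setE (span G)) -topredE. Qed.

HB.instance Definition _ := GRing.isZmodClosed.Build V span_pred
  (GRing.submod_closedB (span_submod G)).

Definition quotmod := {ideal_quot span_pred}.

HB.instance Definition _ := GRing.Zmodule.on quotmod.

Definition quot_pi (v : V) : quotmod := \pi_({ideal_quot span_pred}) v.

Lemma quot_pi_eq (u v : V) : quot_pi u = quot_pi v <-> span G (u - v).
Proof.
by rewrite -span_predP Quotient.idealrBE; split=> /eqP.
Qed.

Lemma quot_pi_surj (x : quotmod) : quot_pi (repr (x : {ideal_quot span_pred})) = x.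
Proof. exact: reprK. Qed.

Lemma quot_piD : {morph quot_pi : u v / u + v}.
Proof. by move=> u v; rewrite /quot_pi raddfD. Qed.

Definition quot_scale (a : R) (x : quotmod) : quotmod :=
  quot_pi (a *: repr (x : {ideal_quot span_pred})).

Lemma quot_piZ a v : quot_pi (a *: v) = quot_scale a (quot_pi v).
Proof.
apply/quot_pi_eq; rewrite -scalerBr.
have [S0 Slin] := span_submod G.
have /(_ (v - repr (quot_pi v : {ideal_quot span_pred})) 0) := Slin a.
rewrite !inE addr0; apply; last by rewrite -[span _ _]inE.
by apply/quot_pi_eq; rewrite quot_pi_surj.
Qed.

Lemma quot_scaleA a b x : quot_scale a (quot_scale b x) = quot_scale (a * b) x.
Proof. by rewrite -(quot_pi_surj x) -!quot_piZ scalerA. Qed.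

Lemma quot_scale1 : left_id 1 quot_scale.
Proof. by move=> x; rewrite -(quot_pi_surj x) -quot_piZ scale1r. Qed.

Lemma quot_scaleDr : right_distributive quot_scale +%R.
Proof.
move=> a x y; rewrite -(quot_pi_surj x) -(quot_pi_surj y).
by rewrite -quot_piD -!quot_piZ -quot_piD scalerDr.
Qed.

Lemma quot_scaleDl x : {morph quot_scale^~ x : a b / a + b}.
Proof.
by move=> a b; rewrite -(quot_pi_surj x) -!quot_piZ -quot_piD scalerDl.
Qed.

HB.instance Definition _ := GRing.Zmodule_isLmodule.Build R quotmod
  quot_scaleA quot_scale1 quot_scaleDr quot_scaleDl.

Lemma quot_pi_is_linear : linear quot_pi.
Proof. by move=> a u v; rewrite quot_piD quot_piZ. Qed.

HB.instance Definition _ :=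
  GRing.isLinear.Build R V quotmod *:%R quot_pi quot_pi_is_linear.

End QuotientModule.

Section FreegLift.
Variables (R : comNzRingType) (K : choiceType) (V : lmodType R) (f : K -> V).

HB.instance Definition _ := GRing.isZmodMorphism.Build {freeg K / R} V
  (fglift f) (lift_is_additive f).

Lemma fglift_scalable : scalable (fglift f).
Proof.
move=> c D; rewrite -[in RHS](freeg_sumE D) [c *: D]/(fgscale c D) /fgscale.
rewrite !(raddf_sum (fglift f)) scaler_sumr; apply: eq_bigr => x _.
by rewrite /= !liftU scalerA.
Qed.

HB.instance Definition _ := GRing.isScalable.Build R {freeg K / R} V *:%R
  (fglift f) fglift_scalable.
End FreegLift.

Section TensorProduct.
Variables (R : comNzRingType) (A M : lmodType R).

Definition bilinear_relators : set {freeg (A * M)%type / R} :=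
  [set z | (exists r a a' m, z = << (r *: a + a', m) >>
                                 - (r *: << (a, m) >> + << (a', m) >>))
        \/ (exists r a m m', z = << (a, r *: m + m') >>
                                 - (r *: << (a, m) >> + << (a, m') >>))].

Definition tensor := quotmod bilinear_relators.

HB.instance Definition _ := GRing.Lmodule.on tensor.

Definition pure_tensor (a : A) (m : M) : tensor :=
  quot_pi bilinear_relators << (a, m) >>.

Definition bilinear_map (P : lmodType R) (b : A -> M -> P) : Prop :=
  (forall m, linear (b^~ m)) /\ (forall a, linear (b a)).

(** The linear map induced by [b]; meaningful only if [b] is bilinear. *)
Definition tensor_lift (P : lmodType R) (b : A -> M -> P) (t : tensor) : P :=
  fglift (fun z => b z.1 z.2) (repr (t : {ideal_quot span_pred bilinear_relators})).

Lemma pure_tensor_bilinear : bilinear_map pure_tensor.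
Proof.
split=> [m r a a'|a r m m']; rewrite /pure_tensor -linearP; apply/quot_pi_eq;
  apply: sub_gen_smallest.
- by left; exists r, a, a', m.
- by right; exists r, a, m, m'.
Qed.

Lemma tensor_lift_pi (P : lmodType R) (b : A -> M -> P) : bilinear_map b ->
  forall z, tensor_lift b (quot_pi bilinear_relators z)
            = fglift (fun z => b z.1 z.2) z.
Proof.
move=> [bl br] z; rewrite /tensor_lift; apply/eqP; rewrite -subr_eq0 -raddfB /=; apply/eqP.
set y := (X in fglift _ X).
have : span bilinear_relators y by apply/quot_pi_eq; rewrite quot_pi_surj.
move: y => y.
suff K : span bilinear_relators `<=`
    [set y | fglift (fun z => b z.1 z.2) y = 0] by exact: K.
apply: smallest_sub.
  split=> [|r u v]; rewrite !inE /= ?linear0 // => u0 v0.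
  by rewrite linearP /= u0 v0 scaler0 addr0.
move=> _ [] [r [a [a' [m ->]]]] /=.
  by rewrite linearB linearP /= !liftU /= !scale1r bl subrr.
by rewrite linearB linearP /= !liftU /= !scale1r br subrr.
Qed.

Lemma tensor_lift_linear (P : lmodType R) (b : A -> M -> P) :
  bilinear_map b -> linear (tensor_lift b).
Proof.
move=> bb r x y; rewrite -(quot_pi_surj x) -(quot_pi_surj y) -linearP.
by rewrite !tensor_lift_pi // linearP.
Qed.

Lemma tensor_lift_pure (P : lmodType R) (b : A -> M -> P) : bilinear_map b ->
  forall a m, tensor_lift b (pure_tensor a m) = b a m.
Proof. by move=> bb a m; rewrite tensor_lift_pi // liftU scale1r. Qed.

Lemma tensor_lift_unique (P : lmodType R) (b : A -> M -> P)
    (g : {linear tensor -> P}) : bilinear_map b ->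
  (forall a m, g (pure_tensor a m) = b a m) -> g =1 tensor_lift b.
Proof.
move=> bb gb x; rewrite -(quot_pi_surj x) tensor_lift_pi //.
move: (repr _) => z; rewrite -(freeg_sumE z) !linear_sum; apply: eq_bigr => k _.
have -> : << coeff k z *g k >> = coeff k z *: << k >> :> {freeg (A * M)%type / R}.
  by apply/eqP/freeg_eqP => l; rewrite coeffZ !coeffU mul1r.
rewrite linearZ [in RHS]linearZ /= liftU scale1r -gb linearZ; by case: k.
Qed.

End TensorProduct.

Definition tensor_map (R : comNzRingType) (A B M : lmodType R) (f : A -> B) :
    tensor A M -> tensor B M :=
  tensor_lift (fun a m => pure_tensor (f a) m).

Lemma tensor_map_pure (R : comNzRingType) (A B M : lmodType R)
    (f : {linear A -> B}) (a : A) (m : M) :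
  tensor_map f (pure_tensor a m) = pure_tensor (f a) m.
Proof.
rewrite /tensor_map tensor_lift_pure //.
have [bl br] := pure_tensor_bilinear B M.
by split=> [m'|a']; [move=> r u v; rewrite linearP bl | exact: br].
Qed.

Definition flat (R : comNzRingType) (M : lmodType R) : Prop :=
  forall (A B : lmodType R) (f : {linear A -> B}),
    injective f -> injective (@tensor_map R A B M f).

(** Exactness of [0 -> F n -> ... -> F 0 -> M -> 0]; the sequence [F] is
    continued by zero modules, so that exactness at [F n] means that
    [F n -> F n.-1] is injective. *)
Definition is_flat_resolution (R : comNzRingType) (M : lmodType R) (n : nat)
    (F : nat -> lmodType R) (d : forall i, {linear F i.+1 -> F i})
    (e : {linear F 0%N -> M}) : Prop :=
  [/\ forall i, flat (F i),
      forall i, (n < i)%N -> forall x : F i, x = 0,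
      range e = setT,
      range (d 0%N) = [set x | e x = 0] &
      forall i, range (d i.+1) = [set x | d i x = 0]].

Definition has_flat_resolution (R : comNzRingType) (M : lmodType R) (n : nat) :=
  exists F d e, @is_flat_resolution R M n F d e.

Definition flat_dim (R : comNzRingType) (M : lmodType R) : \bar int :=
  infimum +oo%E [set (n%:Z)%:E | n in has_flat_resolution M].

Definition weak_gl_dim (R : comNzRingType) : \bar int :=
  supremum -oo%E [set x | exists M : lmodType R, x = flat_dim M].

(** [infimum] and [supremum] take a default value; the next facts show that it
    is not used here, except for [flat_dim M = +oo]. *)
Lemma flat_dim_min (R : comNzRingType) (M : lmodType R) (n : nat) :
  has_flat_resolution M n ->
  exists k : nat, [/\ has_flat_resolution M k, flat_dim M = (k%:Z)%:E &
    forall j, has_flat_resolution M j -> (k <= j)%N].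
Proof.
move=> Mn; have /ex_minnP[k /asboolP Mk kmin] :
  exists k, `[< has_flat_resolution M k >] by exists n; apply/asboolP.
have kmin' j : has_flat_resolution M j -> (k <= j)%N.
  by move=> Mj; apply/kmin/asboolP.
exists k; split=> //; rewrite /flat_dim; set S := (X in infimum _ X).
have Sk : S k%:Z%:E by exists k.
have infk : infimums S k%:Z%:E.
  split=> [_ [j /kmin' kj <-]|y]; first by rewrite lee_fin lez_nat.
  by apply.
rewrite /infimum; case: eqP => [S0|_]; first by rewrite S0 in Sk.
exact: xget_subset1 infk (@is_subset1_infimums _ _ _).
Qed.

Lemma flat_dim_pinfty (R : comNzRingType) (M : lmodType R) :
  (forall n, ~ has_flat_resolution M n) -> flat_dim M = +oo%E.
Proof.
move=> noM; rewrite /flat_dim /infimum; case: eqP => // S0; exfalso; apply: S0.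
by apply/seteqP; split=> // x [n Mn _]; case: (noM n Mn).
Qed.

Lemma weak_gl_dim_pinfty (R : comNzRingType) :
  weak_gl_dim R = +oo%E <->
  forall n : nat, exists M : lmodType R, (n%:Z%:E < flat_dim M)%E.
Proof.
pose S : set (\bar int) := [set x | exists M : lmodType R, x = flat_dim M].
have S_nat x : S x -> x = +oo%E \/ exists k : nat, x = k%:Z%:E.
  move=> [M ->]; have [[n Mn]|noM] := pselect (exists n, has_flat_resolution M n).
    by have [k [_ -> _]] := flat_dim_min Mn; right; exists k.
  by left; apply: flat_dim_pinfty => n Mn; apply: noM; exists n.
have S0 : S !=set0 by exists (flat_dim (R^o : lmodType R)); exists (R^o : lmodType R).
have supE x : supremums S x -> weak_gl_dim R = x.
  move=> Sx; rewrite /weak_gl_dim /supremum -/S.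
  case: eqP => [S00|_]; first by case: S0 => z; rewrite S00.
  exact: xget_subset1 Sx (@is_subset1_supremums _ _ _).
have [unb|/existsNP[n nub]] := pselect
    (forall n : nat, exists M : lmodType R, (n%:Z%:E < flat_dim M)%E).
  split=> // _; apply: supE; split=> [y _|y Sy]; first exact: leey.
  case: y Sy => [k||] Sy //.
    have [M ltM] := unb `|k|%N; have := Sy _ (ex_intro _ M erefl).
    move=> /(lt_le_trans ltM); rewrite lte_fin => /lt_le_trans/(_ (ler_norm k)).
    by rewrite abszE ltxx.
  have [M ltM] := unb 0%N; have := Sy _ (ex_intro _ M erefl).
  by move=> /(lt_le_trans ltM).
split=> [wR|/(_ n)//]; exfalso.
have ubn (M : lmodType R) : (flat_dim M <= n%:Z%:E)%E.
  by rewrite leNgt; apply/negP => ltM; apply: nub; exists M.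
have /ex_minnP[k /asboolP kub kmin] :
    exists k : nat, `[< ubound S k%:Z%:E >].
  by exists n; apply/asboolP => _ [M ->].
suff /supE : supremums S k%:Z%:E by rewrite wR.
split=> // y Sy; case: (S0) => x Sx.
have [yoo|[j xj]] := S_nat _ Sx.
  by have := kub _ Sx; rewrite yoo.
have := Sy _ Sx; rewrite xj; case: y Sy => [[l|l]||] //= Sy; rewrite ?leey //.
by rewrite lee_fin lez_nat => _; apply/kmin/asboolP.
Qed.

Definition ideal (R : comNzRingType) (I : set R) : Prop :=
  submod_closed [in (I : set R^o)].

Lemma idealP (R : comNzRingType) (I : set R) :
  ideal I <-> I 0 /\ forall a x y, I x -> I y -> I (a * x + y).
Proof.
split=> [[I0 Il]|[I0 Il]].
  split; first by move: I0; rewrite inE.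
  by move=> a x y Ix Iy; have := Il a x y; rewrite !inE; apply.
by split=> [|a x y]; rewrite !inE //; apply: Il.
Qed.

Definition ideal_gen (R : comNzRingType) (G : set R) : set R :=
  span (G : set R^o).

Definition ideal_mul (R : comNzRingType) (I J : set R) : set R :=
  ideal_gen [set x * y | x in I & y in J].

Definition ideal_exp (R : comNzRingType) (I : set R) (k : nat) : set R :=
  iter k (ideal_mul I) setT.

Definition maximal_ideal (R : comNzRingType) (I : set R) : Prop :=
  [/\ ideal I, I <> setT &
      forall J, ideal J -> I `<=` J -> J = I \/ J = setT].

Definition local_ring (R : comNzRingType) (m : set R) : Prop :=
  maximal_ideal m /\ forall n, maximal_ideal n -> n = m.

Definition nilradical (R : comNzRingType) : set R :=
  [set x | exists n, x ^+ n = 0].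
Arguments nilradical : clear implicits.

Definition content (R : comNzRingType) (f : {poly R}) : set R :=
  ideal_gen [set f`_i | i in [set: nat]].

Definition gaussian (R : comNzRingType) : Prop :=
  forall f g : {poly R}, ideal_mul (content f) (content g) = content (f * g).

(* Main.v *)
From HB Require Import structures.
From mathcomp Require Import all_boot all_order all_algebra.
From mathcomp Require Import boolp classical_sets constructive_ereal.
From mathcomp Require Import ring zify.
Require Import Defs.

(** The theorem holds because such a ring is a chain ring up to small errors,
    and over a chain ring with nil maximal ideal a flat resolution of length
    [n] would force a fixed power of every element to kill [Tor_1].

    Ring side. In a local Gaussian ring, of any two elements one is a multiple
    of the other plus a square-zero error orthogonal to the divisor
    ([orth_div_total]). For a nilpotent [x], iterating this shows that any two
    elements are comparable for divisibility up to an error killed by [x]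
    ([almost_chain]). In a chain ring with nil maximal ideal, a principal ideal
    [b R] is nearly its own double annihilator; here this becomes: for each [b]
    there is [b'] with [b b' = 0] and [x^2 (0 : b') <= b R]
    ([almost_double_annihilator]).

    Homological side. If [F] is flat, [c g = 0] implies that [g] lies in
    [(0 : c) F]. Let [0 -> K -> F -> M -> 0] be exact, with [F] flat, and
    suppose that [x^e] kills [Tor_1(R/aR, K)] for all [a]. Then [x^(e+2)] kills
    [Tor_1(R/cR, M)] for all [c] ([kills_tor1_step]): if [c g] lies in [K], then
    it is killed by [c'], so that [x^e c g] lies in [(0 : c') K] and
    [x^(e+2) c g] in [c K]. Climbing a flat resolution of length [n] from its
    zero end up to [M] gives the exponent [2 n + 2], which depends neither on
    [M] nor on [x].

    Contradiction. As the maximal ideal is not nilpotent, it has elements [x]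
    of arbitrarily large nilpotency index [L] ([unbounded_nilpotency]). With [h]
    about [L / 2], the module [M = R / x^h R] has [Tor_1(R/x^h R, M) = R/x^h R]
    up to isomorphism, since [x^(2h) = 0], and [x^(2n+2)] does not kill it. So
    [M] has no flat resolution of length at most [n]. *)

Set Implicit Arguments.
Unset Strict Implicit.
Unset Printing Implicit Defensive.

Import Order.TTheory GRing.Theory Num.Theory.
Local Open Scope classical_set_scope.
Local Open Scope ring_scope.

(** * Submodules generated by a set *)

Section Span.
Variables (R : comNzRingType) (V : lmodType R).
Implicit Types (G N : set V).

Lemma span_min G N : N 0 -> (forall a u v, N u -> N v -> N (a *: u + v)) ->
  G `<=` N -> span G `<=` N.
Proof.
move=> N0 Nlin GN; apply: smallest_sub => //.
by split=> [|a u v]; rewrite !inE //; apply: Nlin.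
Qed.

Lemma sub_span G v : G v -> span G v.
Proof. exact: sub_gen_smallest. Qed.

Lemma span0 G : span G 0.
Proof. by have [] := span_submod G; rewrite inE. Qed.

Lemma span_lin G a u v : span G u -> span G v -> span G (a *: u + v).
Proof.
by have [_ /(_ a u v)] := span_submod G; rewrite !inE.
Qed.

Lemma spanD G u v : span G u -> span G v -> span G (u + v).
Proof. by move=> Gu Gv; have := @span_lin G 1 u v Gu Gv; rewrite scale1r. Qed.
End Span.

(** * Divisibility in local Gaussian rings *)

Section LinearPolynomials.
Variables (R : comNzRingType) (Rgauss : gaussian R).

(** The Gaussian condition enters only through pairs of linear polynomials
    [a X + b] and [p X + q]: the products of their coefficients lie in the
    content of the product polynomial. *)
Lemma gaussian_linear (a b p q : R) :
  let J z := exists r1 r2 r3,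
    z = r1 * (a * p) + r2 * (a * q + b * p) + r3 * (b * q) in
  [/\ J (a * p), J (a * q), J (b * p) & J (b * q)].
Proof.
move=> J.
pose f : {poly R} := a *: 'X + b%:P.
pose g : {poly R} := p *: 'X + q%:P.
have fgE : f * g = (a * p) *: 'X^2 + (a * q + b * p) *: 'X + (b * q)%:P.
  by rewrite /f /g -!mul_polyC !(polyCM, polyCD); ring.
have key i j : J (f`_i * g`_j).
  have : content (f * g) (f`_i * g`_j).
    rewrite -Rgauss; apply: sub_span.
    exists f`_i; first by apply: sub_span; exists i.
    by exists g`_j => //; apply: sub_span; exists j.
  apply: (span_min (V := R^o)).
  - by exists 0, 0, 0; rewrite !mul0r !addr0.
  - move=> r u v [r1 [r2 [r3 ->]]] [s1 [s2 [s3 ->]]].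
    exists (r * r1 + s1), (r * r2 + s2), (r * r3 + s3).
    by rewrite /GRing.scale /=; ring.
  move=> _ [l _ <-]; rewrite fgE !coefD !coefZ coefXn coefX coefC.
  case: l => [|[|[|l]]] /=.
  - by exists 0, 0, 1; ring.
  - by exists 0, 1, 0; ring.
  - by exists 1, 0, 0; ring.
  - by exists 0, 0, 0; ring.
have f0 : f`_0 = b by rewrite /f coefD coefZ coefX coefC /= mulr0 add0r.
have f1 : f`_1 = a by rewrite /f coefD coefZ coefX coefC /= mulr1 addr0.
have g0 : g`_0 = q by rewrite /g coefD coefZ coefX coefC /= mulr0 add0r.
have g1 : g`_1 = p by rewrite /g coefD coefZ coefX coefC /= mulr1 addr0.
by split; [move: (key 1 1)|move: (key 1 0)|move: (key 0 1)|move: (key 0 0)];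
  rewrite ?f0 ?f1 ?g0 ?g1.
Qed.
End LinearPolynomials.

(** Divisibility of [b] by [a] up to a negligible error: the ring modulo its
    square-zero elements sees [a %| b], and multiplying by [a] removes the
    error altogether. *)
Definition orth_div (R : comNzRingType) (a b : R) :=
  exists s c, [/\ b = a * s + c, a * c = 0 & c * c = 0].

Section LocalGaussian.
Variables (R : comNzRingType) (Rgauss : gaussian R).

(** The hypothesis says that [a] is a root of the quadratic form
    [T^2 - u b T - v b^2]. The linear polynomial [(u b - a) X + b] is the
    conjugate of [a X + b]: their product has all its coefficients in
    [b^2 R], whence [(a, b)^2 = b^2 R]. In particular [a b = s b^2], and the
    error is [c = a - s b], which is orthogonal to [b] and satisfies
    [c^2 = t b^2]. The product [(b X + c) (c X - t b)] is then zero, so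
    that the coefficients [c] and [c] have a zero product. *)
Lemma orth_div_sqr (a b u v : R) :
  a * a = u * (a * b) + v * (b * b) -> orth_div b a.
Proof.
move=> aaE.
have [_ [r1 [r2 [r3 abE]]] _ _] := gaussian_linear Rgauss a b (u * b - a) b.
pose s := r2 * u + r3 - r1 * v.
have {}abE : a * b = s * (b * b).
  rewrite {1}abE.
  have -> : a * (u * b - a) = - (v * (b * b)) by rewrite mulrBr aaE; ring.
  by rewrite /s; ring.
exists s, (a - s * b).
pose t := u * s + v - s * s.
have bc0 : b * (a - s * b) = 0.
  have -> : b * (a - s * b) = a * b - s * (b * b) by ring.
  by rewrite abE subrr.
have ccE : (a - s * b) * (a - s * b) = t * (b * b).
  have -> : (a - s * b) * (a - s * b)
     = a * a - s * (a * b) *+ 2 + s * s * (b * b) by ring.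
  by rewrite aaE abE /t; ring.
split=> //; first by ring.
move: (a - s * b) bc0 ccE => c bc0 ccE.
have [_ _ [x [y [z ->]]] _] := gaussian_linear Rgauss b c c (- (t * b)).
rewrite bc0 ccE mulr0 add0r.
have -> : b * - (t * b) + t * (b * b) = 0 by ring.
have -> : c * - (t * b) = - t * (b * c) by ring.
by rewrite bc0 !mulr0 addr0.
Qed.

Variables (m : set R) (idm : ideal m) (m1 : ~ m 1).
Hypothesis unitm : forall r, m r \/ exists s, s * r = 1.

(** By [orth_div_sqr] it is enough to put [a^2] in [(a b, b^2)], or [b^2] in
    [(a b, a^2)]. The pair [a X + b], [a X - b] gives
    [a b = al a^2 + be b^2], which suffices if [al] or [be] is a unit. If not,
    the pair [a X + b], [b X + a] expresses [a^2] by [a b] and [a^2 + b^2], and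
    replacing [a b] yields a relation between [a^2] and [b^2] with one unit
    coefficient. *)
Lemma orth_div_total (a b : R) : orth_div a b \/ orth_div b a.
Proof.
have [m0 mlin] := (idealP m).1 idm.
have [_ [r1 [r2 [r3 abE]]] _ _] := gaussian_linear Rgauss a b a (- b).
pose al := - r1; pose be := r3.
have {}abE : a * b = al * (a * a) + be * (b * b).
  have -> : a * b = - (a * - b) by ring.
  by rewrite abE /al /be; ring.
have [mal|[w wal]] := unitm al; last first.
  right; apply: (@orth_div_sqr a b w (- (w * be))).
  rewrite abE -[LHS]mul1r -wal; ring.
have [mbe|[w wbe]] := unitm be; last first.
  left; apply: (@orth_div_sqr b a w (- (w * al))).
  by rewrite [b * a]mulrC abE -[LHS]mul1r -wbe; ring.
have [_ [p1 [q [p3 aaE]]] _ _] := gaussian_linear Rgauss a b b a.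
pose p := p1 + p3.
have {}aaE : (1 - q - p * al) * (a * a) = (p * be + q) * (b * b).
  have : a * a - (p * (a * b) + q * (a * a + b * b)) = 0.
    by rewrite {1}aaE /p; ring.
  rewrite abE => /eqP; rewrite subr_eq0 => /eqP E.
  by rewrite mulrBl mulrBl mul1r {1}E; ring.
have [mq|[w wq]] := unitm q.
  have [mx|[w wE]] := unitm (1 - q - p * al).
    case: m1; have := mlin 1 _ _ mx (mlin p _ _ mal mq).
    by have -> : 1 * (1 - q - p * al) + (p * al + q) = 1 by ring.
  right; apply: (@orth_div_sqr a b 0 (w * (p * be + q))).
  by rewrite mul0r add0r -mulrA -aaE mulrA wE mul1r.
have [mx|[z zE]] := unitm (p * be + q).
  case: m1; rewrite -wq.
  have mq : m q.
    have := mlin (- p) _ _ mbe mx.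
    by have -> : - p * be + (p * be + q) = q by ring.
  by have := mlin w _ _ mq m0; rewrite addr0.
left; apply: (@orth_div_sqr b a 0 (z * (1 - q - p * al))).
by rewrite mul0r add0r -mulrA aaE mulrA zE mul1r.
Qed.
End LocalGaussian.

(** * Rings that are almost chain rings *)

Section OrthogonalDivision.
Variables (R : comNzRingType).
Hypothesis orth_total : forall a b : R, orth_div a b \/ orth_div b a.

Lemma sqr0_mul0 (c d : R) : c * c = 0 -> d * d = 0 -> c * d = 0.
Proof.
move=> cc dd; have [] := orth_total c d => -[s [e [-> e0 _]]].
  by rewrite mulrDr mulrA cc e0; ring.
by rewrite mulrDl mulrAC dd [e * d]mulrC e0; ring.
Qed.

(** Dividing [r] by [x] as often as possible: [x] is nilpotent, so either the
    process stops at a quotient [w] that divides [x], or [r] is a pure error.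
    Each division contributes an error killed by [x], and so is its product
    with the power of [x] already divided out; the sum of the errors is again
    killed by [x]. *)
Lemma power_decomposition (x r : R) : (exists n, x ^+ n = 0) ->
  x * r = 0 \/ exists j w c, [/\ r = x ^+ j * w + c, x * c = 0 & orth_div w x].
Proof.
move=> [n xn0].
suff [//|[s [c [rE xc]]]] : (x * r = 0 \/ exists j w c,
    [/\ r = x ^+ j * w + c, x * c = 0 & orth_div w x]) \/
    exists s c, r = x ^+ n * s + c /\ x * c = 0.
  by left; rewrite rE xn0 mul0r add0r.
elim: n {xn0} => [|n [IH|[s [c [rE xc]]]]].
- by right; exists r, 0; rewrite expr0 mul1r addr0 mulr0.
- by left.
have [|] := orth_total x s => [[t [e [sE xe _]]]|wx]; last first.
  by left; right; exists n, s, c.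
right; exists t, (x ^+ n * e + c); split.
  by rewrite rE sE exprSr; ring.
by rewrite mulrDr xc mulrCA xe mulr0 addr0.
Qed.

(** Decompose [a] as [x^i v] and [b] as [x^j w] up to errors. If [i < j], one
    factor [x] of [x^j] is almost a multiple of [v], and [b] one of [a]; if
    [i = j], compare [v] with [w]. The error of a division by [v] is killed by
    [x] because [v] divides [x] and square-zero elements annihilate each
    other. *)
Lemma almost_chain (x a b : R) : (exists n, x ^+ n = 0) ->
  (exists t e, b = a * t + e /\ x * e = 0) \/
  (exists t e, a = b * t + e /\ x * e = 0).
Proof.
move=> xnil.
have [xa|[i [v [c [aE xc [va [d [xvE vd dd]]]]]]]] :=
    power_decomposition a xnil.
  by right; exists 0, a; rewrite mulr0 add0r.
have [xb|[j [w [c' [bE xc' [wb [d' [xwE wd' dd']]]]]]]] :=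
    power_decomposition b xnil.
  by left; exists 0, b; rewrite mulr0 add0r.
wlog ij : a b i j v w c c' va wb d d' aE bE xc xc' xvE xwE vd wd' dd dd' /
    (i <= j)%N.
  move=> W; case: (leqP i j) => [|/ltnW] ij.
    exact: (W a b i j v w c c' va wb d d').
  have [|] := W b a j i w v c' c wb va d' d
    bE aE xc' xc xwE xvE wd' vd dd' dd ij.
    by right.
  by left.
move: ij; rewrite leq_eqVlt => /orP[/eqP ij|ij].
  rewrite -{j}ij in bE.
  have [] := orth_total v w => -[t [e [E ve ee]]]; [left | right].
    exists t, (x ^+ i * e + c' - t * c); split; first by rewrite bE aE E; ring.
    have xe : x * e = 0.
      by rewrite xvE mulrDl mulrAC ve (sqr0_mul0 dd ee); ring.
    by rewrite mulrBr mulrDr xc' mulrCA xe mulrCA xc; ring.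
  exists t, (x ^+ i * e + c - t * c'); split; first by rewrite bE aE E; ring.
  have xe : x * e = 0.
    by rewrite xwE mulrDl mulrAC ve (sqr0_mul0 dd' ee); ring.
  by rewrite mulrBr mulrDr xc mulrCA xe mulrCA xc'; ring.
left.
have [k jE] : exists k, j = (k + i).+1 by exists (j - i.+1)%N; lia.
exists (x ^+ k * w * va), (x ^+ (k + i) * w * d + c' - x ^+ k * w * va * c).
split.
  by rewrite bE aE jE exprSr exprD [X in _ * X * w]xvE; ring.
have xd : x * d = 0 by rewrite xvE mulrDl mulrAC vd dd; ring.
by rewrite mulrBr mulrDr xc' mulrCA xd mulrCA xc; ring.
Qed.

(** The annihilator of [b] is witnessed by a power of [x]: take [x^k] with [k]
    minimal such that it kills [b]. The case [k <= 1] is immediate; otherwise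
    write [b = x b' + d] with [x d = 0], so that [x^k b'] is not zero. An element [y] killed by [x^k] cannot then divide
    [b'], even up to an error, hence [b'] almost divides [y], and so [b]
    divides [x^2 y]. If instead [b] almost divides [x], it divides [x^2]. *)
Lemma almost_double_annihilator (x b : R) : (exists n, x ^+ n = 0) ->
  exists k, b * x ^+ k = 0 /\
    forall y, x ^+ k * y = 0 -> exists r, x ^+ 2 * y = b * r.
Proof.
move=> xnil.
have ex : exists k, b * x ^+ k == 0.
  by case: xnil => n xn; exists n; rewrite xn mulr0.
have /ex_minnP[k /eqP bk kmin] := ex.
exists k; split=> // y.
case: k bk kmin => [|[|k]] bk kmin xky.
- by exists 0; rewrite -[y]mul1r -(expr0 x) xky !mulr0.
- by exists 0; rewrite exprS -mulrA xky !mulr0.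
have [[b' [d [bE xd _]]]|[t [d [xE bd dd]]]] := orth_total x b; last first.
  have xd : x * d = 0 by rewrite xE mulrDl mulrAC bd dd; ring.
  exists (x * t * y).
  have -> : x ^+ 2 = b * (x * t) by rewrite expr2 {2}xE mulrDr xd; ring.
  by ring.
have [[r [e [yE xe]]]|[r [e [b'E xe]]]] := almost_chain b' y xnil.
  exists (x * r); rewrite yE.
  have -> : b * (x * r) = x ^+ 2 * (b' * r) + (x * d) * r by rewrite bE; ring.
  by rewrite xd mulrDr expr2 -(mulrA x x e) xe; ring.
suff /kmin : b * x ^+ k.+1 == 0 by rewrite ltnn.
have -> : b * x ^+ k.+1 = x ^+ k.+2 * b' + x ^+ k * (x * d).
  by rewrite bE !exprS; ring.
by rewrite xd b'E mulrDr mulrA xky exprSr -(mulrA _ x e) xe mul0r !mulr0 !addr0.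
Qed.
End OrthogonalDivision.

(** * Flat modules and annihilators *)

Section AlmostFlat.
Variables (R : comNzRingType).

(** The submodule [(0 : c) S], when [S] is a submodule. *)
Definition ann_span (V : lmodType R) (c : R) (S : set V) : set V :=
  span [set z | exists a s, [/\ c * a = 0, S s & z = a *: s]].

Lemma pure_tensorZl (A M : lmodType R) r (a : A) (x : M) :
  pure_tensor (r *: a) x = r *: pure_tensor a x.
Proof.
have [bl _] := pure_tensor_bilinear A M.
exact: (GRing.scalable_linear (bl x)).
Qed.

Lemma pure_tensorZr (A M : lmodType R) r (a : A) (x : M) :
  pure_tensor a (r *: x) = r *: pure_tensor a x.
Proof.
have [_ br] := pure_tensor_bilinear A M.
exact: (GRing.scalable_linear (br a)).
Qed.

Lemma pure_tensor0r (A M : lmodType R) (a : A) : pure_tensor a (0 : M) = 0.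
Proof. by have := pure_tensorZr 0 a (0 : M); rewrite !scale0r. Qed.

Section FlatAnnihilator.
Variables (F : lmodType R) (c : R).

Let annc : set R^o := [set a | c * a = 0].

Let span_annc (a : R^o) : span annc a <-> c * a = 0.
Proof.
split; last exact: sub_span.
apply: (@span_min _ _ annc annc) => //; rewrite /annc /=.
- by rewrite mulr0.
by move=> r u v cu cv; rewrite /GRing.scale /= mulrDr mulrCA cu cv mulr0 addr0.
Qed.

Let A := quotmod annc.
Let rep (x : A) : R^o := repr (x : {ideal_quot span_pred annc}).

Let rep_pi (a : R^o) : c * (rep (quot_pi annc a) - a) = 0.
Proof. by apply/span_annc/quot_pi_eq; rewrite quot_pi_surj. Qed.

Let rep_linear r (x y : A) : c * (rep (r *: x + y) - (r * rep x + rep y)) = 0.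
Proof.
have -> : r *: x + y = quot_pi annc (r *: rep x + rep y).
  by rewrite linearP /= !quot_pi_surj.
exact: rep_pi.
Qed.

Let mulc (x : A) : R^o := c * rep x.

Let mulc_linear : linear mulc.
Proof.
move=> r x y; apply/eqP; rewrite -subr_eq0 -(rep_linear r x y) /mulc /GRing.scale /=.
by apply/eqP; ring.
Qed.

HB.instance Definition _ := GRing.isLinear.Build R A R^o *:%R mulc mulc_linear.

Let mulc_inj : injective mulc.
Proof.
move=> x y /eqP; rewrite -subr_eq0 /mulc -mulrBr => /eqP E.
by rewrite -(quot_pi_surj x) -(quot_pi_surj y); apply/quot_pi_eq/span_annc.
Qed.

(** Multiplication by [c] embeds [R / (0 : c)] into [R]; by flatness it stays
    injective after tensoring with [F], where it becomes the map
    [F / (0 : c) F -> F] induced by [c]. *)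
Lemma flat_annihilator (g : F) : flat F -> c *: g = 0 -> ann_span c setT g.
Proof.
move=> /(_ _ _ mulc mulc_inj) Finj cg.
pose H : set F := [set z | exists a s, [/\ c * a = 0, setT s & z = a *: s]].
have Hann a (f : F) : c * a = 0 -> span H (a *: f).
  by move=> ca; apply: sub_span; exists a, f.
(* The inverse of [f |-> 1 (x) f], from [A (x) F] to [F / (0 : c) F]. *)
have bb : bilinear_map (fun (x : A) (f : F) => quot_pi H (rep x *: f)).
  split=> [f r x y|x r f f'].
    rewrite -linearP /=; apply/quot_pi_eq.
    rewrite scalerA -scalerDl -scalerBl; apply: Hann; exact: rep_linear.
  by rewrite -linearP scalerDr !scalerA mulrC.
pose one : A := quot_pi annc (1 : R^o).
have : pure_tensor one g = pure_tensor one 0.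
  apply: Finj; rewrite !tensor_map_pure /= pure_tensor0r.
  have -> : mulc one = c *: (1 : R^o).
    apply/eqP; rewrite -subr_eq0 -(rep_pi 1); apply/eqP.
    by rewrite /mulc /GRing.scale /=; ring.
  by rewrite pure_tensorZl -pure_tensorZr cg pure_tensor0r.
move=> /(congr1 (tensor_lift (fun (x : A) (f : F) => quot_pi H (rep x *: f)))).
rewrite !tensor_lift_pure // scaler0 => /quot_pi_eq; rewrite subr0 => Hg.
have -> : g = (1 - rep one) *: g + rep one *: g.
  by rewrite -scalerDl subrK scale1r.
apply: spanD => //; apply: Hann.
by have := rep_pi 1; rewrite -opprB mulrN => /eqP; rewrite oppr_eq0 => /eqP.
Qed.
End FlatAnnihilator.

(** For a submodule [S], the group [Tor_1(R/cR, S)] is the kernel of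
    [cR (x) S -> S], that is the quotient of [{k in S | c k = 0}] by
    [(0 : c) S]; [y] annihilates it for all [c]. *)
Definition kills_tor1 (V : lmodType R) (S : set V) (y : R) :=
  forall c k, S k -> c *: k = 0 -> ann_span c S (y *: k).

(** * Climbing a flat resolution *)

Section Resolution.
Variable x : R.
Hypothesis double_ann : forall b : R, exists b', b * b' = 0 /\
  forall y, b' * y = 0 -> exists r, x ^+ 2 * y = b * r.

(** An elementary form of dimension shifting for [Tor_1]. A relation [c p(g) = 0]
    puts [c g] in the kernel, where [c'] kills it. The hypothesis on the kernel
    and the choice of [c'] give [x^(e+2) c g = c h] with [h] in the kernel.
    Then [x^(e+2) g - h] is killed by [c] in the flat module [F] and has the
    same image as [x^(e+2) g]. *)
Lemma kills_tor1_step (F V : lmodType R) (p : {linear F -> V}) e : flat F ->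
  kills_tor1 [set f | p f = 0] (x ^+ e) ->
  kills_tor1 (range p) (x ^+ (e + 2)).
Proof.
move=> flatF defK c _ [g _ <-] pcg.
have [c' [cc' c'P]] := double_ann c.
have Kcg : p (c *: g) = 0 by rewrite linearZ.
have c'cg : c' *: (c *: g) = 0 by rewrite scalerA mulrC cc' scale0r.
have [h [ph hE]] : exists h,
    p h = 0 /\ x ^+ 2 *: (x ^+ e *: (c *: g)) = c *: h.
  have := defK c' _ Kcg c'cg.
  move: (x ^+ e *: (c *: g)) => z.
  apply: (@span_min _ _ _ (fun z => exists h, p h = 0 /\ x ^+ 2 *: z = c *: h)).
  - by exists 0; rewrite linear0 !scaler0.
  - move=> r u v [h [ph uE]] [h' [ph' vE]]; exists (r *: h + h').
    rewrite linearP ph ph' scaler0 addr0; split=> //.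
    rewrite scalerDr scalerA mulrC -scalerA uE vE.
    by rewrite scalerDr !scalerA mulrC.
  - move=> _ [a [s [/c'P[r aE] ps ->]]]; exists (r *: s).
    by rewrite linearZ /= ps scaler0 !scalerA aE.
have : ann_span c setT (x ^+ (e + 2) *: g - h).
  apply: flat_annihilator => //; rewrite scalerBr -hE !scalerA.
  rewrite -scalerBl -[RHS](scale0r g) exprD; congr (_ *: _); ring.
have -> : x ^+ (e + 2) *: p g = p (x ^+ (e + 2) *: g - h).
  by rewrite linearB ph subr0 linearZ.
move: (_ - h) => z.
apply: (@span_min _ _ _ (fun z => ann_span c (range p) (p z))).
- by rewrite linear0; exact (@span0 _ _ _).
- by move=> r u v pu pv; rewrite linearP; exact (@span_lin _ _ _ r _ _ pu pv).
- move=> _ [a [s [ca _ ->]]]; rewrite linearZ; apply: sub_span.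
  by exists a, (p s); split=> //; exists s.
Qed.

Lemma resolution_kills_tor1 (M : lmodType R) n : has_flat_resolution M n ->
  kills_tor1 [set: M] (x ^+ (2 * n + 2)).
Proof.
move=> [F [d [e [flatF F0 eT ker0 kerS]]]].
(* The image of [d n] is zero; each step towards [M] costs a factor [x^2]. *)
have defd j i : (i + j)%N = n -> kills_tor1 (range (d i)) (x ^+ (2 * j)).
  elim: j i => [|j IH] i ijn.
    move=> c _ [z _ <-] _; rewrite (F0 i.+1 _ z); last by lia.
    rewrite linear0 scaler0; exact (@span0 _ _ _).
  have -> : (2 * j.+1 = 2 * j + 2)%N by lia.
  apply: kills_tor1_step; first exact: flatF.
  by rewrite -kerS; apply: IH; lia.
rewrite -eT; apply: kills_tor1_step; first exact: flatF.
by rewrite -ker0; apply: defd.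
Qed.

(** The class of [1] in [M = R / x^h R] is killed by [x^h]. If [x^e] killed
    [Tor_1(R/x^h R, M)], then [x^e] would lie in [(0 : x^h) + x^h R], and
    multiplying by [x^h] would give [x^(h+e) = 0]. *)
Lemma no_flat_resolution h n : x ^+ (h + h) = 0 -> x ^+ (h + (2 * n + 2)) <> 0 ->
  ~ has_flat_resolution (quotmod [set x ^+ h : R^o]) n.
Proof.
move=> x2h xN /resolution_kills_tor1.
set G := [set _]; set e := (2 * n + 2)%N => defM.
have spanG (a : R^o) : span G a -> x ^+ h * a = 0.
  apply: (@span_min _ _ G (fun a : R^o => x ^+ h * a = 0)).
  - exact: mulr0.
  - by move=> r u v hu hv; rewrite mulrDr mulrCA hu hv mulr0 addr0.
  - by move=> _ ->; rewrite -exprD.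
have pi0 : x ^+ h *: quot_pi G (1 : R^o) = 0.
  rewrite -linearZ -[RHS](linear0 (quot_pi G)); apply/quot_pi_eq.
  rewrite subr0; apply: sub_span; exact: mulr1.
have : exists a : R^o,
    x ^+ h * a = 0 /\ x ^+ e *: quot_pi G (1 : R^o) = quot_pi G a.
  have := defM (x ^+ h) (quot_pi G 1) I pi0.
  move: (x ^+ e *: _) => z.
  apply: (@span_min _ _ _ (fun z => exists a : R^o,
    x ^+ h * a = 0 /\ z = quot_pi G a)).
  - by exists 0; rewrite mulr0 linear0.
  - move=> r u v [a [ha ->]] [b [hb ->]]; exists (r *: a + b); rewrite linearP.
    by split=> //; rewrite mulrDr mulrCA ha hb mulr0 addr0.
  - move=> _ [a [s [ha _ ->]]]; rewrite -(quot_pi_surj s).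
    exists (a *: repr (s : {ideal_quot span_pred G})); rewrite linearZ; split=> //.
    by rewrite mulrA ha mul0r.
move=> [a [ha]]; rewrite -linearZ => /quot_pi_eq/spanG.
rewrite mulrBr ha subr0 [_ *: _]mulr1 -exprD; exact: xN.
Qed.
End Resolution.
End AlmostFlat.

(** * Elements of large nilpotency index *)

Section NilpotencyIndex.
Variables (R : comNzRingType) (m : set R).
Hypothesis orth_total : forall a b : R, orth_div a b \/ orth_div b a.

(** For two factors, [z z'] is a multiple of [z^2] or of [z'^2], as one of them
    divides the other up to an orthogonal error; the general case halves the
    list. *)
Lemma prod_dvd_power k (s : seq R) : size s = (2 ^ k)%N ->
  (forall y, y \in s -> m y) ->
  exists z r, m z /\ \prod_(y <- s) y = r * z ^+ (2 ^ k).
Proof.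
elim: k s => [|k IH] s sz sm.
  case: s sz sm => [|y [|]] // _ sm; exists y, 1; split.
    by apply: sm; rewrite inE.
  by rewrite big_seq1 mul1r.
have [||z [r [mz zE]]] := IH (take (2 ^ k) s).
- by rewrite size_take sz; case: ltnP => //; rewrite leq_exp2l //; lia.
- by move=> y /mem_take; apply: sm.
have [||z' [r' [mz' z'E]]] := IH (drop (2 ^ k) s).
- by rewrite size_drop sz expnS; lia.
- by move=> y /mem_drop; apply: sm.
have prodE : \prod_(y <- s) y = r * r' * (z * z') ^+ (2 ^ k).
  by rewrite -(cat_take_drop (2 ^ k) s) big_cat /= zE z'E exprMn; ring.
have [] := orth_total z z' => -[t [c [E zc _]]].
  exists z, (r * r' * t ^+ (2 ^ k)); split=> //; rewrite prodE.
  have -> : z * z' = t * z ^+ 2 by rewrite E mulrDr zc; ring.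
  by rewrite exprMn -exprM -expnS mulrA.
exists z', (r * r' * t ^+ (2 ^ k)); split=> //; rewrite prodE.
have -> : z * z' = t * z' ^+ 2 by rewrite E mulrDl [c * z']mulrC zc; ring.
by rewrite exprMn -exprM -expnS mulrA.
Qed.

(** Powers of an ideal being defined by recursion, the multiplier [p] serves to
    absorb the factors already taken out of the product. *)
Lemma ideal_exp_kill k p :
  (forall s : seq R, size s = k -> (forall y, y \in s -> m y) ->
     p * \prod_(y <- s) y = 0) ->
  forall y, ideal_exp m k y -> p * y = 0.
Proof.
elim: k p => [|k IH] p ps y /=.
  by have := ps [::] erefl; rewrite big_nil mulr1 => -> //; rewrite mul0r.
apply: (@span_min _ R^o _ (fun y : R => p * y = 0)).
- exact: mulr0.
- by move=> r u v pu pv; rewrite mulrDr mulrCA pu pv mulr0 addr0.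
move=> _ [a ma [b mb <-]]; rewrite mulrA; apply: IH mb => s sz sm.
have -> : p * a * \prod_(y <- s) y = p * \prod_(y <- a :: s) y.
  by rewrite big_cons mulrA.
apply: ps => [|z]; first by rewrite /= sz.
by rewrite inE => /orP[/eqP->|/sm].
Qed.

(** If [z^N = 0] for all [z] in [m], then every product of [2^N] elements of [m]
    is zero, as a multiple of some [z^(2^N)] with [2^N >= N]. *)
Lemma unbounded_nilpotency :
  (forall k : nat, (1 <= k)%N -> ideal_exp m k <> [set 0]) ->
  forall N, exists x, m x /\ x ^+ N <> 0.
Proof.
move=> mk N; apply: contrapT => nox.
have xN z : m z -> z ^+ N = 0.
  by move=> mz; apply: contrapT => zN; apply: nox; exists z.
apply: (mk (2 ^ N)%N); first by rewrite expn_gt0.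
apply/seteqP; split=> [y my|_ ->].
  rewrite /= -[y]mul1r; apply: (@ideal_exp_kill (2 ^ N)) my => s sz sm.
  have [z [r [mz ->]]] := prod_dvd_power sz sm.
  by rewrite -(subnK (ltnW (ltn_expl N (isT : 1 < 2)%N))) exprD xN // !mulr0.
by have := span0; case: (2 ^ N)%N => //= n; apply.
Qed.
End NilpotencyIndex.

Theorem theorem4p8 (R : comNzRingType) (m : set R)
    (Rloc : local_ring m)
    (Rgauss : gaussian R)
    (nil_m : nilradical R = m)
    (m_non_nilpotent :
      forall k : nat, (1 <= k)%N -> ideal_exp m k <> [set 0%R]%classic) :
  weak_gl_dim R = +oo%E.
Proof.
have [[idm mT mmax] _] := Rloc.
have [m0 mlin] := (idealP m).1 idm.
have nilP r : m r -> exists n, r ^+ n = 0 by rewrite -nil_m.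
have m1 : ~ m 1 by move=> /nilP[n]; rewrite expr1n => /eqP; rewrite oner_eq0.
(* If [r] is not in [m], then [m + r R = R] by maximality, and [1 - y] is a
   unit for [y] nilpotent. *)
have unitm r : m r \/ exists s, s * r = 1.
  pose J : set R := [set z | exists y s, m y /\ z = y + s * r].
  have idJ : ideal J.
    apply/idealP; split; first by exists 0, 0; rewrite mul0r addr0.
    move=> a _ _ [y [s [my ->]]] [y' [s' [my' ->]]].
    by exists (a * y + y'), (a * s + s'); split; [exact: mlin|ring].
  have Jr : J r by exists 0, 1; rewrite mul1r add0r.
  have [||JE|JE] := mmax J.
  - exact: idJ.
  - by move=> y my; exists y, 0; rewrite mul0r addr0.
  - by left; rewrite -JE.
  have [y [s [/nilP[n yn] E]]] : J 1 by rewrite JE.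
  right; exists ((\sum_(i < n) y ^+ i) * s).
  rewrite -mulrA; have -> : s * r = 1 - y by rewrite E; ring.
  by rewrite mulrC -opprB mulNr -subrX1 yn sub0r opprK.
have orth := orth_div_total Rgauss idm m1 unitm.
apply/weak_gl_dim_pinfty => n.
(* The minimal [L] with [x^L = 0] exceeds [h + (2 n + 2)], where [h] is [L / 2]
   rounded up, as soon as [L] exceeds [4 n + 5]. *)
have [x [mx xN]] := unbounded_nilpotency orth m_non_nilpotent (4 * n + 5).
have xnil := nilP x mx.
have /ex_minnP[L /eqP xL Lmin] : exists L, x ^+ L == 0.
  by case: xnil => L xL; exists L; apply/eqP.
have LN : (4 * n + 5 < L)%N.
  rewrite ltnNge; apply/negP => le; apply: xN.
  by rewrite -(subnK le) exprD xL mulr0.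
pose h := uphalf L.
have hL : (L <= h + h <= L.+1)%N by rewrite /h uphalfE; lia.
exists (quotmod [set x ^+ h : R^o]).
have double_ann (b : R) : exists b', b * b' = 0 /\
    forall y, b' * y = 0 -> exists r, x ^+ 2 * y = b * r.
  by have [k [bk kP]] := almost_double_annihilator orth b xnil; exists (x ^+ k).
have nores k : (k <= n)%N ->
    ~ has_flat_resolution (quotmod [set x ^+ h : R^o]) k.
  move=> kn; apply: no_flat_resolution => //.
    have /andP[le _] := hL.
    by rewrite -(subnK le) exprD xL mulr0.
  by move=> /eqP/Lmin; lia.
have [[k kres]|nok] := pselect
    (exists k, has_flat_resolution (quotmod [set x ^+ h : R^o]) k).
  have [j [jres -> _]] := flat_dim_min kres.
  rewrite lte_fin ltz_nat ltnNge; apply/negP => /nores; exact.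
rewrite flat_dim_pinfty ?ltry // => k kres; apply: nok; by exists k.
Qed.
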